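(* Let $Q\subset M$ be a compact and controlled invariant set for the control system $x_{k+1}=f(x_k,u_k)$. Then for every quasi-stationary measure $\eta$ on $Q$ (corresponding to a probability measure $\nu$ on $\Omega$) the metric invariance entropy with respect to $\mu=\nu^{\mathbb N}\times\eta$ satisfies $$h_\mu(Q)\le h_{inv}(Q),$$ where $h_{inv}(Q)$ is the topological invariance entropy of $Q$.
   Context: Setting. $\mathbb N=\{0,1,2,\ldots\}$. $M$ and $\Omega$ are metric spaces, $f:M\times\Omega\to M$ is continuous, and the control system is $x_{k+1}=f(x_k,u_k)$, $k\in\mathbb N$. Put $\mathcal U=\Omega^{\mathbb N}$ with the product topology; $\varphi(k,x,u)$ denotes the solution at time $k$ with $\varphi(0,x,u)=x$ and control $u=(u_k)$ (it depends only on $u_0,\ldots,u_{k-1}$, so finite control sequences are also allowed). $\nu$ is a Borel probability measure on $\Omega$ and $p(x,A)=\nu\{\omega\in\Omega: f(x,\omega)\in A\}$. For a closed set $Q\subset M$, a quasi-stationary measure on $Q$ (for $\nu$) is a Borel probability measure $\eta$ on $M$, supported in $Q$ (so $\eta(Q)=1$), such that for some constant $\rho\in(0,1]$ one has $\rho\,\eta(A)=\int_Q p(x,A)\,\eta(dx)$ for all Borel sets $A\subset Q$. The skew product map is $S:\mathcal U\times M\to\mathcal U\times M$, $S(u,x)=(\theta u,f(x,u_0))$, where $\theta$ is the shift $(u_k)_{k\ge0}\mapsto(u_{k+1})_{k\ge 0}$. Let $\phi(x)=x\log x$ for $x>0$, $\phi(0)=0$ (natural logarithm). For a measure $m$ and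 a finite collection $\mathfrak C$ of pairwise disjoint measurable sets put $H_m(\mathfrak C)=-\sum_{C\in\mathfrak C}\phi(m(C))$. An invariant $(Q,\eta)$-partition $\mathcal C_\tau=\mathcal C_\tau(\mathcal P,F)$ consists of an integer $\tau\ge1$, a finite partition $\mathcal P=\{P_1,\ldots,P_q\}$ of $Q$ into Borel sets and a map $F:\mathcal P\to\Omega^\tau$ such that for every $P\in\mathcal P$: $\varphi(k,x,F(P))\in Q$ for $k=1,\ldots,\tau$ and $\eta$-a.a. $x\in P$. For a word $a=[a_0,\ldots,a_{n-1}]$ with $a_j\in\{1,\ldots,q\}$, $n\ge1$, let $u_a=(F(P_{a_0}),\ldots,F(P_{a_{n-1}}))\in\Omega^{n\tau}$ be the concatenation; $a$ is admissible if $\eta\{x\in Q:\varphi(i\tau,x,u_a)\in P_{a_i},\ i=0,\ldots,n-1\}>0$. For $P\in\mathcal P$ let $$A(P)=\{u\in\mathcal U:\varphi(k,x,u)\in Q\text{ for }k=1,\ldots,\tau\text{ and }\eta\text{-a.a. }x\in P\}\times P.$$ For an admissible word $a$ of length $n$ let $D_a=A(P_{a_0})\cap S^{-\tau}A(P_{a_1})\cap\cdots\cap S^{-(n-1)\tau}A(P_{a_{n-1}})$, and let $\mathfrak A_n(\mathcal C_\tau)$ be the collection of all $D_a$, $a$ admissible of length $n$ (sets with $\mu(D_a)=0$ are omitted). The metric invariance entropy is $$h_\mu(Q)=\limsup_{\tau\to\infty}\inf_{\mathcal C_\tau}h_\mu(\mathcal C_\tau,Q),\qquad h_\mu(\mathcal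 C_\tau,Q)=\limsup_{n\to\infty}\frac1{n\tau}H_{\rho^{-(n-1)\tau}\mu}(\mathfrak A_n(\mathcal C_\tau)),$$ where for fixed $\tau$ the infimum is over all invariant $(Q,\eta)$-partitions $\mathcal C_\tau$ with time step $\tau$; $h_\mu(Q):=\infty$ if no invariant $(Q,\eta)$-partition exists. Topological invariance entropy. A compact set $Q\subset M$ is controlled invariant if for every $x\in Q$ there is $\omega_x\in\Omega$ with $f(x,\omega_x)\in Q$. For $\tau\ge1$, a set $\mathcal R\subset\mathcal U$ is $(\tau,Q)$-spanning if for all $x\in Q$ there is $u\in\mathcal R$ with $\varphi(n,x,u)\in Q$ for all $n=1,\ldots,\tau$. Let $r_{inv}(\tau,Q)$ be the minimal number of elements of such a set ($:=\infty$ if no finite $(\tau,Q)$-spanning set exists). Then $h_{inv}(Q):=\lim_{\tau\to\infty}\frac1\tau\log r_{inv}(\tau,Q)$. *)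

(* Defs.v *)
From HB Require Import structures.
From mathcomp Require Import all_boot all_order all_algebra.
From mathcomp Require Import all_classical all_reals all_analysis.
Set Implicit Arguments.
Unset Strict Implicit.
Unset Printing Implicit Defensive.
Import Order.TTheory GRing.Theory Num.Theory.

Local Open Scope classical_set_scope.
Local Open Scope ring_scope.

(* Measurable types are pointed in MathComp-Analysis. All metric spaces below
   carry a probability measure, so asking for a point loses no generality. *)
#[short(type="pmetricType")]
HB.structure Definition PointedMetric (R : numDomainType) :=
  { T of Metric R T & Pointed T }.

Notation borel T := (g_sigma_algebraType (@open T)).

Section ControlSystem.
Context {R : realType} {M Omega : pmetricType R}.
Variable f : M * Omega -> M.

Notation U := {ptws nat -> Omega}.

Fixpoint sol (k : nat) (x : M) (u : nat -> Omega) : M :=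
  if k is k'.+1 then f (sol k' x u, u k') else x.

(* Solution for a finite control sequence; used only for k <= size w, where
   the padding by [point] plays no role. *)
Definition sol_fin (k : nat) (x : M) (w : seq Omega) : M :=
  sol k x (nth point w).

Definition transition (nu : probability (borel Omega) R) (x : M) (A : set M)
    : \bar R :=
  nu [set w | A (f (x, w))].

Definition quasi_stationary (nu : probability (borel Omega) R) (Q : set M)
    (eta : probability (borel M) R) (rho : R) : Prop :=
  [/\ 0 < rho <= 1,
      eta Q = 1%E &
      forall A : set (borel M), measurable A -> A `<=` Q ->
        (rho%:E * eta A = \int[eta]_(x in Q) transition nu x A)%E].

(* nuN is nu^N: the Borel measure on U (product topology) that gives every
   finite-dimensional measurable rectangle its product mass (by the pi-lambda
   theorem there is only one such measure when Omega is separable). *)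
Definition power_measure (nu : probability (borel Omega) R)
    (nuN : probability (borel U) R) : Prop :=
  forall (n : nat) (A : nat -> set (borel Omega)),
    (forall i, measurable (A i)) ->
    nuN [set u | forall i, (i < n)%N -> A i (u i)]
      = (\prod_(i < n) nu (A i))%E.

Definition skew (z : U * M) : U * M :=
  ((fun k => z.1 k.+1), f (z.2, z.1 0%N)).

(* The blocks of a [partition] are nonempty and pairwise disjoint, so a map
   defined on the set of blocks is the same as a map defined on indices. *)
Record inv_partition (Q : set M) (eta : probability (borel M) R)
    (tau : nat) := InvPartition {
  ip_size : nat;
  ip_block : 'I_ip_size -> set M;
  ip_control : 'I_ip_size -> tau.-tuple Omega;
  ip_tau_gt0 : (0 < tau)%N;
  ip_measurable : forall i, measurable (ip_block i : set (borel M));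
  ip_partition : partition setT ip_block Q;
  ip_invariant : forall i, {ae eta, forall x, ip_block i x ->
    forall k, (1 <= k <= tau)%N -> Q (sol_fin k x (ip_control i))} }.

Definition concat_control (Q : set M) (eta : probability (borel M) R)
    (tau : nat) (C : inv_partition Q eta tau) (n : nat)
    (a : n.-tuple 'I_(ip_size C)) : seq Omega :=
  flatten [seq tval (ip_control j) | j <- a].

Definition admissible (Q : set M) (eta : probability (borel M) R)
    (tau : nat) (C : inv_partition Q eta tau) (n : nat)
    (a : n.-tuple 'I_(ip_size C)) : Prop :=
  (0 < eta [set x | Q x /\ forall i : 'I_n,
     ip_block (tnth a i) (sol_fin (i * tau) x (concat_control a))])%E.

Definition block_set (Q : set M) (eta : probability (borel M) R)
    (tau : nat) (C : inv_partition Q eta tau) (i : 'I_(ip_size C))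
    : set (U * M) :=
  [set u : U | {ae eta, forall x, ip_block i x ->
     forall k, (1 <= k <= tau)%N -> Q (sol k x u)}] `*` ip_block i.

Definition word_set (Q : set M) (eta : probability (borel M) R)
    (tau : nat) (C : inv_partition Q eta tau) (n : nat)
    (a : n.-tuple 'I_(ip_size C)) : set (U * M) :=
  \bigcap_(i : 'I_n) (iter (i * tau) skew @^-1` block_set (tnth a i)).

Definition word_sets (Q : set M) (eta : probability (borel M) R)
    (mu : set (U * M) -> \bar R) (tau : nat) (C : inv_partition Q eta tau)
    (n : nat) : set (set (U * M)) :=
  [set word_set a | a in
    [set a : n.-tuple 'I_(ip_size C) | admissible a /\ mu (word_set a) <> 0%E]].

(* [ln] vanishes at 0, so this is 0 at x = 0. *)
Definition xlnx (x : R) : R := x * ln x.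

Definition entropy (T : Type) (m : set T -> \bar R) (CC : set (set T)) : R :=
  - \sum_(C \in CC) xlnx (fine (m C)).

Definition partition_entropy (Q : set M) (eta : probability (borel M) R)
    (rho : R) (mu : set (U * M) -> \bar R) (tau : nat)
    (C : inv_partition Q eta tau) : \bar R :=
  limn_esup (fun n : nat =>
    ((n * tau)%:R^-1 *
     entropy (fun A => ((rho ^- (n.-1 * tau))%:E * mu A)%E)
       (word_sets mu C n))%:E).

(* The infimum of the empty set is +oo, so this is +oo when there is no
   invariant partition. *)
Definition metric_inv_entropy (Q : set M) (eta : probability (borel M) R)
    (rho : R) (mu : set (U * M) -> \bar R) : \bar R :=
  limn_esup (fun tau : nat =>
    ereal_inf (range (@partition_entropy Q eta rho mu tau))).

Definition controlled_invariant (Q : set M) : Prop :=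
  forall x, Q x -> exists w, Q (f (x, w)).

Definition spanning (tau : nat) (Q : set M) (S : set U) : Prop :=
  forall x, Q x ->
    exists2 u, S u & forall n, (1 <= n <= tau)%N -> Q (sol n x u).

Definition r_inv (tau : nat) (Q : set M) : \bar R :=
  ereal_inf [set (n%:R)%:E | n in
    [set n : nat | exists2 S : set U, (S #= `I_n)%card & spanning tau Q S]].

Definition top_inv_entropy (Q : set M) : \bar R :=
  limn (fun tau : nat => ((tau%:R^-1)%:E * lne (r_inv tau Q))%E).

End ControlSystem.

(* Main.v *)
Require Import Defs.
From HB Require Import structures.
From mathcomp Require Import all_boot all_order all_algebra.
From mathcomp Require Import finmap.
From mathcomp Require Import all_classical all_reals all_analysis.
Set Implicit Arguments.
Unset Strict Implicit.
Unset Printing Implicit Defensive.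
Import Order.TTheory GRing.Theory Num.Theory.
Local Open Scope classical_set_scope.
Local Open Scope ring_scope.

(** Fix a time step tau. A spanning set of r controls cuts Q into at most r
    pieces, each kept in Q during tau steps by one of the controls. Words of
    length n over these pieces number at most r ^ n, and the corresponding word
    sets are disjoint. If their total mass under mu = nuN \x eta is at most
    rho ^ ((n - 1) tau), then after normalisation they carry mass at most 1, and
    the Gibbs inequality bounds their entropy by 1 + n ln r
    ([partition_entropy_le]). Dividing by n tau and letting n, then tau, go to
    infinity gives the claim, since ln r_inv(tau) / tau converges by Fekete's
    lemma ([top_inv_entropy_cvg]).

    The mass bound rests on the identity
      mu {(u, x) : the trajectory stays in Q up to time k and ends in B}
        = rho ^ k eta(B)                                      ([survive_law]),
    which says that conditioning on survival multiplies the law of the current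
    state by rho at each step. It would suffice that word sets consist of
    trajectories surviving up to time (n - 1) tau. A control in a word set
    however keeps only eta-almost every point of a block in Q, while the
    trajectory at hand may enter the block at an exceptional point. This is
    cured by choosing the blocks well. A block P is called [charged] when each
    nonempty relatively open subset of P has positive measure; as Q is closed
    and f continuous, invariance almost everywhere on a charged block is
    invariance at every point ([charged_ae]). Since Q is second countable, each
    piece is charged up to a null set ([charged_part]); the null remainders are
    collected in one extra block N. A trajectory in a word set then survives, or
    visits N after having survived so far, and the latter has probability 0 by
    the identity above ([word_set_sub], [word_sets_mass]). The extra block
    replaces r by r + 1, which is invisible as tau goes to infinity.

    The spaces M and Omega need not be separable, so a continuous map on a
    product need not be measurable for the product of the Borel sigma-algebras.
    Restricting the state to the compact set Q restores measurability, because
    only one of the two factors has to be second countable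
    ([measurable_open_over_compact]). *)

(** * Measurability of continuous maps over a compact set of states *)

(** The centres of finite covers of K by balls of radius 1 / (n + 1) give a
    countable family of open sets that serves as a base of the topology at all
    points of K, even though the ambient space may not be second countable. *)
Lemma compact_countable_base (R : realType) (T : pseudoPMetricType R)
    (K : set T) : compact K ->
  exists B : nat -> set T, (forall n, open (B n)) /\
    forall x V, K x -> nbhs x V -> exists n, B n x /\ B n `<=` V.
Proof.
move=> cK.
pose F n (z : T) : set T := (ball z n.+1%:R^-1)°.
have posn n : 0 < n.+1%:R^-1 :> R by rewrite invr_gt0.
have h n : finite_subset_cover setT (F n) K.
  move: cK; rewrite compact_cover; apply.
    by move=> z _; exact: open_interior.
  by move=> z _; exists z => //; rewrite /F /interior; exact: nbhsx_ballx.
have /choice[D hD] : forall n, exists D : {fset T}, K `<=` cover [set` D] (F n).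
  by move=> n; have [D _ KD] := h n; exists D.
(* [G (n, j)] is the ball around the j-th centre of the n-th cover. *)
pose G (p : nat * nat) : set T :=
  if onth (finmap.enum_fset (D p.1)) p.2 is Some z then F p.1 z else set0.
exists (fun n => if choice.unpickle n is Some p then G p else set0); split=> [n|x V Kx].
  case: choice.unpickle => [p|]; last exact: open0.
  by rewrite /G; case: onth => [z|]; [exact: open_interior|exact: open0].
move=> /nbhs_ballP[_/posnumP[e] eV].
have [//|N] := @ltr_add_invr R 0%R (e%:num/2) _; rewrite add0r => Ne.
have [w wD Fw] := hD N x Kx.
exists (choice.pickle (N, index w (finmap.enum_fset (D N)))); rewrite choice.pickleK /G /=.
have -> : onth (finmap.enum_fset (D N)) (index w (finmap.enum_fset (D N))) = Some w.
  by rewrite onthE (nth_map w) ?nth_index ?index_mem.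
split=> // z bz; apply: eV; rewrite [e%:num]splitr.
apply: (@ball_triangle _ _ w).
  by apply: (le_ball (ltW Ne)); apply/ball_sym; apply: interior_subset.
by apply: (le_ball (ltW Ne)); apply: interior_subset.
Qed.

Lemma measurable_compact (R : realType) (X : pmetricType R) (K : set X) :
  compact K -> measurable (K : set (borel X)).
Proof.
move=> cK; rewrite -[K]setCK; apply: measurableC; apply: sub_sigma_algebra.
by apply: closed_openC; apply: compact_closed => //; exact: metric_hausdorff.
Qed.

(** The coordinates [y] and [x] are abstract measurable maps instead of the two
    projections of a product, which leaves open how the sigma-algebra on the
    carrier of [Y] is presented. *)
Section over_compact.
Context {R : realType} {X : pmetricType R} {Y : topologicalType}.
Context {d : measure_display} {T : measurableType d}.
Context {y : T -> Y} {x : T -> borel X}.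
Hypothesis my : forall V : set Y, open V -> measurable (y @^-1` V).
Hypothesis mx : measurable_fun setT x.

(** With B a countable base at the points of K, an open set of the product is
    over K the union of the rectangles V n * B n, where V n is the largest open
    set whose product with B n lies in it. *)
Lemma measurable_open_over_compact (K : set X) (O : set (Y * X)) :
  compact K -> open O -> measurable [set t | K (x t) /\ O (y t, x t)].
Proof.
move=> cK oO; have [B [oB baseB]] := compact_countable_base cK.
pose V n : set Y := [set b | forall a, B n a -> O (b, a)]°.
rewrite (_ : [set t | _] = \bigcup_n (y @^-1` V n `&` x @^-1` (B n `&` K))).
  apply: bigcupT_measurable => n; apply: measurableI.
    by apply: my; exact: open_interior.
  rewrite -[X in measurable X]setTI; apply: mx => //.
  apply: measurableI; last exact: measurable_compact.
  by apply: sub_sigma_algebra; exact: oB.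
apply/seteqP; split=> [t /= [Kx Oyx]|t [n _ [/= Vy [Bx Kx]]]].
  have : nbhs (y t, x t) O by exact: open_nbhs_nbhs.
  case=> -[A1 A2] /= [nA1 nA2] AO.
  have [n [Bnx BA2]] := baseB (x t) A2 Kx nA2; exists n => //; split=> //=.
  rewrite /V /interior /=; apply: filterS nA1 => b Ab a Ba.
  by apply: (AO (b, a)); split=> //; exact: BA2.
by split=> //; exact: (interior_subset Vy).
Qed.

Lemma measurable_fun_over_compact (Z : ptopologicalType) (K : set X)
    (g : Y * X -> Z) : compact K -> continuous g ->
  measurable_fun [set t | K (x t)] ((fun t => g (y t, x t)) : T -> borel Z).
Proof.
move=> cK cg; apply: (@measurability _ _ _ (borel Z) _ _ (@open Z)) => //.
move=> _ [V oV <-]; apply: (@measurable_open_over_compact K (g @^-1` V)) => //.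
by apply: open_comp => // z _; exact: cg.
Qed.

End over_compact.

(** * Survival probabilities under a quasi-stationary measure *)

(** A measure that factorises on rectangles is determined on the product
    sigma-algebra; the restriction to [Q] and the factor [c] account for the mass
    lost by trajectories leaving Q. *)
Lemma product_law_unique d1 d2 (T1 : measurableType d1) (T2 : measurableType d2)
    (R : realType) (P1 : probability T1 R) (P2 : probability T2 R)
    (Q : set T2) (c : R) (m : {measure set (T1 * T2) -> \bar R}) :
  measurable Q -> 0 <= c ->
  (forall A B, measurable A -> measurable B ->
     m (A `*` B) = (c%:E * (P1 A * P2 (B `&` Q)))%E) ->
  forall E, measurable E ->
    m E = (c%:E * \int[P2]_(y in Q) P1 (ysection E y))%E.
Proof.
move=> mQ c0 mAB E mE.
have mTQ : measurable ([set: T1] `*` Q) by exact: measurableX.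
pose m2 := mscale (NngNum c0) (mrestr (P1 \x^ P2)%E mTQ).
have -> : m E = m2 E.
  apply: (measure_unique
    [set A `*` B | A in @measurable _ T1 & B in @measurable _ T2]
    (fun=> setT)) => //.
  - exact: measurable_prod_measurableType.
  - move=> _ _ [A1 mA1 [B1 mB1 <-]] [A2 mA2 [B2 mB2 <-]].
    exists (A1 `&` A2); first exact: measurableI.
    by exists (B1 `&` B2); [exact: measurableI|exact: setXI].
  - by move=> _; exists setT => //; exists setT => //; rewrite setXTT.
  - by apply/seteqP; split => // z _; exists 0%N.
  - move=> _ [A mA [B mB <-]]; rewrite mAB //.
    change (c%:E * (P1 A * P2 (B `&` Q)) =
      c%:E * (P1 \x^ P2) (A `*` B `&` [set: T1] `*` Q))%E.
    have -> : A `*` B `&` [set: T1] `*` Q = A `*` (B `&` Q).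
      by apply/seteqP; split=> [[a b] [[/= ? ?] [? ?]]|[a b] [/= ? [? ?]]].
    by rewrite product_measure2E //; exact: measurableI.
  - move=> _; rewrite -setXTT mAB // probability_setT mul1e setTI.
    apply: (@le_lt_trans _ _ (c%:E * 1)%E); last by rewrite mule1 ltry.
    by rewrite lee_pmul ?lee_fin // probability_le1.
change (c%:E * (P1 \x^ P2) (E `&` [set: T1] `*` Q) =
  c%:E * \int[P2]_(y in Q) P1 (ysection E y))%E.
rewrite /product_measure2; congr (_ * _)%E.
rewrite [RHS]integral_mkcond; apply: eq_integral => y _ /=.
rewrite patchE; case: ifPn => yQ.
  by congr (P1 _); rewrite ysectionI in_ysectionX // setIT.
by rewrite ysectionI notin_ysectionX // setI0 measure0.
Qed.

Section dynamics.
Context {R : realType} {M Omega : pmetricType R} (f : M * Omega -> M).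
Local Notation U := {ptws nat -> Omega}.

Lemma sol_ext k x (u v : nat -> Omega) :
  (forall i, (i < k)%N -> u i = v i) -> sol f k x u = sol f k x v.
Proof.
elim: k => //= k IH uv; rewrite IH ?uv // => i ik; exact/uv/ltnW.
Qed.

Lemma sol_add j k x (u : nat -> Omega) :
  sol f (j + k) x u = sol f k (sol f j x u) (fun i => u (i + j)%N).
Proof.
elim: k => [|k IH]; first by rewrite addn0.
by rewrite addnS /= IH addnC.
Qed.

(** The iterates of the skew product shift the control and advance the state,
    which turns the definition of word sets into conditions on trajectories. *)
Lemma iter_skew j (z : U * M) :
  iter j (Defs.skew f) z = ((fun i => z.1 (i + j)%N) : U, sol f j z.2 z.1).
Proof.
elim: j => [|j IH] /=.
  by rewrite [LHS]surjective_pairing; congr (_, _); apply/funext => i; rewrite addn0.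
rewrite IH /Defs.skew /=; congr (_, _); apply/funext => i; by rewrite addnS addSn.
Qed.

Hypothesis cf : continuous f.

(** Continuity of the control is only asked coordinatewise, so that the lemma
    covers shifted and constant controls as well as the identity of U. *)
Lemma continuous_sol (T : topologicalType) (x : T -> M) (u : T -> nat -> Omega) k :
  continuous x -> (forall i, continuous (fun t => u t i)) ->
  continuous (fun t => sol f k (x t) (u t)).
Proof.
move=> cx cu; elim: k => // k IH t /=.
apply: (@continuous_comp _ _ _ (fun t => (sol f k (x t) (u t), u t k)) f).
  by apply: cvg_pair; [exact: IH|exact: cu].
exact: cf.
Qed.

Lemma continuous_coord i : continuous (fun u : U => u i).
Proof. exact: (@proj_continuous nat (fun=> Omega) i). Qed.

End dynamics.

Section survival.
Context {R : realType} {M Omega : pmetricType R} (f : M * Omega -> M).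
Local Notation U := {ptws nat -> Omega}.

Definition survive (Q : set M) (k : nat) (B : set M) : set (U * M) :=
  [set z | (forall i, (i <= k)%N -> Q (sol f i z.2 z.1)) /\
           B (sol f k z.2 z.1)].

(** The controls that are still to be applied after time [k]: a survival event up
    to time [k] depends only on the earlier ones. *)
Definition future_cylinder (k n : nat) (A : nat -> set Omega) : set (U * M) :=
  [set z | forall i, (i < n)%N -> A i (z.1 (i + k)%N)].

Hypothesis cf : continuous f.
Variables (Q : set M) (cQ : compact Q).

Let mQ : measurable (Q : set (borel M)) := measurable_compact cQ.

Lemma measurable_over_Q (B : set (borel M)) k : measurable B ->
  measurable ([set z | Q z.2 /\ B (sol f k z.2 z.1)] : set (borel U * borel M)).
Proof.
move=> mB; have cg : continuous (fun z : U * M => sol f k z.2 z.1).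
  apply: continuous_sol => // [z|i z]; first exact: cvg_snd.
  apply: (@continuous_comp _ _ _ (fst : U * M -> U) (fun u : U => u i)).
    exact: cvg_fst.
  exact: continuous_coord.
have mfst (V : set U) : open V -> measurable ((fst : borel U * borel M -> U) @^-1` V).
  move=> oV; rewrite -[X in measurable X]setTI; apply: measurable_fst => //.
  exact: sub_sigma_algebra.
have mTQ : measurable ([set z | Q z.2] : set (borel U * borel M)).
  by rewrite -[X in measurable X]setTX; exact: measurableX.
exact: (@measurable_fun_over_compact _ _ _ _ _ _ _ mfst measurable_snd _ _ _ cQ cg mTQ B mB).
Qed.

Lemma measurable_survive k (B : set (borel M)) : measurable B ->
  measurable (survive Q k B : set (borel U * borel M)).
Proof.
move=> mB.
have -> : survive Q k B = [set z | Q z.2 /\ B (sol f k z.2 z.1)] `&`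
    \bigcap_(i < k.+1) [set z | Q z.2 /\ Q (sol f i z.2 z.1)].
  apply/seteqP; split=> [z [zQ zB]|z [[zQ zB] h]]; split=> //.
  - by split=> //; exact: (zQ 0%N).
  - by move=> i /= ik; split; [exact: (zQ 0%N)|exact: zQ].
  - by move=> i ik; have [] := h i ik.
apply: measurableI; first exact: measurable_over_Q.
by apply: fin_bigcap_measurable => // i _; exact: measurable_over_Q.
Qed.

Lemma measurable_coord k : measurable_fun [set: borel U]
  ((fun u => u k) : borel U -> borel Omega).
Proof.
apply: (@measurability _ _ _ (borel Omega) _ _ (@open Omega)) => //.
move=> _ [V oV <-]; rewrite setTI; apply: sub_sigma_algebra.
by apply: open_comp => // u _; exact: continuous_coord.
Qed.

Lemma measurable_future_cylinder k n (A : nat -> set (borel Omega)) :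
  (forall i, measurable (A i)) ->
  measurable (future_cylinder k n A : set (borel U * borel M)).
Proof.
move=> mA.
have -> : future_cylinder k n A =
    \bigcap_(i < n) (((fun u : U => u (i + k)%N) @^-1` A i) `*` setT).
  apply/seteqP; split=> [z h i /= ?|z h i ?]; first by split=> //; exact: h.
  by have [] := h i _.
apply: fin_bigcap_measurable => // i _; apply: measurableX => //.
by rewrite -[X in measurable X]setTI; exact: measurable_coord.
Qed.

Lemma measurable_cylinder n (A : nat -> set (borel Omega)) :
  (forall i, measurable (A i)) ->
  measurable ([set u : U | forall i, (i < n)%N -> A i (u i)] : set (borel U)).
Proof.
move=> mA; have -> : [set u : U | forall i, (i < n)%N -> A i (u i)] =
    \bigcap_(i < n) ((fun u : U => u i) @^-1` A i).
  by apply/seteqP; split=> u h i; exact: h.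
apply: fin_bigcap_measurable => // i _.
by rewrite -[X in measurable X]setTI; exact: measurable_coord.
Qed.

Variables (nu : probability (borel Omega) R) (nuN : probability (borel U) R).
Hypothesis hnuN : power_measure nu nuN.
Variables (eta : probability (borel M) R) (rho : R).
Hypothesis heta : quasi_stationary f nu Q eta rho.

(** Survival up to time k is independent of the future controls and has the
    conditionally invariant law. Carrying the future cylinder through the
    induction makes independence part of the statement: the induction hypothesis,
    applied with the control u_k prescribed in addition, says that (u_k, x_k)
    restricted to survival has law c nu \x eta on rectangles, hence on all
    measurable sets. Integrating over u_k is one step of the transition kernel,
    which multiplies eta by rho. *)
Lemma survive_cylinder_law k n (A : nat -> set (borel Omega)) (B : set (borel M)) :
  (forall i, measurable (A i)) -> measurable B -> B `<=` Q ->
  (nuN \x eta)%E (survive Q k B `&` future_cylinder k n A) =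
  ((rho ^+ k)%:E * eta B * \prod_(i < n) nu (A i))%E.
Proof.
have [/andP[rho0 _] _ eta_qs] := heta.
elim: k n A B => [|k IH] n A B mA mB BQ.
  rewrite expr0 mul1e muleC -hnuN // -product_measure1E //; last first.
    exact: measurable_cylinder.
  congr (_ _); apply/seteqP; split=> [[u x] [[_ /= Bx] h]|[u x] [/= h Bx]].
    by split=> // i ?; have := h i; rewrite addn0; exact.
  split; last by move=> i /= ?; rewrite addn0; exact: h.
  by split=> // -[|//] _; exact: BQ.
have mD : measurable (survive Q k Q `&` future_cylinder k.+1 n A :
    set (borel U * borel M)).
  by apply: measurableI; [exact: measurable_survive|exact: measurable_future_cylinder].
(* The pair (u_k, x_k); the state is made constant outside Q, where it need not
   be measurable. *)
pose h (z : borel U * borel M) : borel Omega * borel M :=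
  (z.1 k, ((fun z : U * M => sol f k z.2 z.1) \_ [set z | Q z.2]) z).
have mh : measurable_fun setT h.
  apply/measurable_fun_pairP; split.
    exact: (measurableT_comp (measurable_coord k) measurable_fst).
  rewrite (_ : snd \o h =
    ((fun z : U * M => sol f k z.2 z.1) \_ [set z | Q z.2])) //.
  apply/(measurable_restrictT _ _).1.
    by rewrite -[X in measurable X]setTX; exact: measurableX.
  by move=> _ E mE; exact: measurable_over_Q.
have [m mE] : exists m : {measure set (borel Omega * borel M) -> \bar R},
    forall E, m E = (nuN \x eta)%E
      (h @^-1` E `&` (survive Q k Q `&` future_cylinder k.+1 n A)).
  (* The measure structure of an image measure depends on the proof [mh] that the
     map is measurable, so that it has to be given by name. *)
  by exists (measure_function_pushforward__canonical__measure_function_Measure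
    (mrestr (nuN \x eta)%E mD) mh).
pose E : set (borel Omega * borel M) := [set z | Q z.2 /\ B (f (z.2, z.1))].
have -> : survive Q k.+1 B `&` future_cylinder k.+1 n A =
    h @^-1` E `&` (survive Q k Q `&` future_cylinder k.+1 n A).
  apply/seteqP; split=> z.
    move=> [[zQ zB] zA]; have zQ' i : (i <= k)%N -> Q (sol f i z.2 z.1).
      by move=> ik; apply: zQ; exact: leqW.
    split; last by split=> //; split=> //; exact: zQ'.
    rewrite /E /h /= patchE mem_set; last exact: (zQ' 0%N).
    by split => //; exact: zQ'.
  move=> [+ [[zQ zQk] zA]].
  rewrite /E /h /= patchE mem_set; last exact: (zQ 0%N).
  move=> [_ zB]; split=> //; split=> // i; rewrite leq_eqVlt => /orP[/eqP->|].
    exact: BQ.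
  by rewrite ltnS; exact: zQ.
rewrite -mE.
have pfin : (\prod_(i < n) nu (A i))%E \is a fin_num.
  by rewrite -hnuN // fin_num_measure //; exact: measurable_cylinder.
have p0 : (0 <= \prod_(i < n) nu (A i))%E by rewrite -hnuN.
rewrite -(fineK pfin); set p := fine _.
rewrite (@product_law_unique _ _ _ _ _ nu eta Q (rho ^+ k * p) m) //.
- transitivity ((rho ^+ k * p)%:E * (rho%:E * eta B))%E.
    congr (_ * _)%E; rewrite eta_qs //; apply: eq_integral => y /set_mem Qy.
    rewrite /transition; congr (nu _); apply/seteqP; split=> w /=.
      by move=> /set_mem[].
    by move=> Bw; apply/mem_set.
  rewrite exprSr !EFinM -!muleA; congr (_ * _)%E.
  by rewrite muleC -muleA.
- by rewrite mulr_ge0 ?exprn_ge0 ?(ltW rho0) // fine_ge0.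
- move=> G B' mG mB'; rewrite mE.
  (* Prescribing u_k in G and the controls from time k + 1 on is prescribing the
     controls from time k on. *)
  pose A' i := if i is i'.+1 then A i' else G.
  have -> : h @^-1` (G `*` B') `&` (survive Q k Q `&` future_cylinder k.+1 n A) =
      survive Q k (B' `&` Q) `&` future_cylinder k n.+1 A'.
    apply/seteqP; split=> z.
      move=> [+ [[zQ zQk] zA]]; rewrite /h /= patchE mem_set; last exact: (zQ 0%N).
      move=> [/= zG zB']; split=> // -[_|i]; first by rewrite /A' add0n.
      by move=> /zA /=; rewrite addnS.
    move=> [[zQ [zB' zQk]] zA]; split; last first.
      split=> // i /= /(zA i.+1); by rewrite addnS.
    rewrite /h /= patchE mem_set; last exact: (zQ 0%N).
    by split=> //; have := zA 0%N isT; rewrite add0n.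
  rewrite IH; last 3 first.
  - by case.
  - exact: measurableI.
  - exact: subIsetr.
  rewrite big_ord_recl /= -[X in (_ * (_ * X))%E](fineK pfin) -/p EFinM.
  by rewrite [(nu G * _)%E]muleC muleACA; congr (_ * _)%E; rewrite muleC.
- have mfst (V : set Omega) : open V ->
      measurable ((fst : borel Omega * borel M -> Omega) @^-1` V).
    move=> oV; rewrite -[X in measurable X]setTI; apply: measurable_fst => //.
    exact: sub_sigma_algebra.
  have cg : continuous (fun z : Omega * M => f (z.2, z.1)).
    move=> z; apply: (@continuous_comp _ _ _ (fun z : Omega * M => (z.2, z.1)) f).
      by apply: cvg_pair; [exact: cvg_snd|exact: cvg_fst].
    exact: cf.
  have mTQ : measurable ([set z | Q z.2] : set (borel Omega * borel M)).
    by rewrite -[X in measurable X]setTX; exact: measurableX.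
  exact: (@measurable_fun_over_compact _ _ _ _ _ _ _ mfst measurable_snd _ _ _ cQ cg mTQ B mB).
Qed.

Lemma survive_law k (B : set (borel M)) : measurable B -> B `<=` Q ->
  (nuN \x eta)%E (survive Q k B) = ((rho ^+ k)%:E * eta B)%E.
Proof.
move=> mB BQ; have := @survive_cylinder_law k 0 (fun=> setT) B _ mB BQ.
by rewrite big_ord0 mule1 => <- //; congr (_ _); apply/seteqP; split=> // z [].
Qed.

End survival.

(** * Charged sets *)

Section charged.
Context {R : realType} {M : pmetricType R} (eta : probability (borel M) R).

(** Equivalently, P lies in the support of the restriction of eta to P. *)
Definition charged (P : set M) : Prop :=
  forall O : set M, open O -> O `&` P !=set0 -> (0 < eta (O `&` P))%E.

(** The points of P outside the closed set W form a relatively open null set, and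
    a charged set has no nonempty one. *)
Lemma charged_ae (P W : set M) :
  measurable (P : set (borel M)) -> charged P -> closed W ->
  {ae eta, forall x, P x -> W x} -> P `<=` W.
Proof.
move=> mP chP cW [N [mN N0 sN]] x Px; apply: contrapT => nWx.
have mO : measurable (~` W `&` P : set (borel M)).
  apply: measurableI => //; apply: sub_sigma_algebra; exact: closed_openC.
have := chP (~` W) (closed_openC cW) (ex_intro _ x (conj nWx Px)).
apply/negP; rewrite -leNgt -N0; apply: le_measure; rewrite ?inE //.
by apply: subset_trans sN => y [nWy Py] /(_ Py).
Qed.

(** Remove from P its intersections of measure 0 with members of a countable base
    of K. These are countably many null sets, and what remains is charged: a
    relatively open null set would lie in the removed part. *)
Lemma charged_part (K P : set M) : compact K -> P `<=` K ->
  measurable (P : set (borel M)) ->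
  exists P' : set (borel M), [/\ P' `<=` P, measurable P', charged P' &
    eta (P `\` P') = 0%E].
Proof.
move=> cK PK mP; have [B [oB baseB]] := compact_countable_base cK.
have mB n : measurable (B n : set (borel M)) by exact: sub_sigma_algebra.
pose Z n : set (borel M) := if eta (B n `&` P) == 0%E then B n `&` P else set0.
have mZ n : measurable (Z n).
  by rewrite /Z; case: ifP => _ //; exact: measurableI.
have Z0 : eta (\bigcup_n Z n) = 0%E.
  apply: measure_negligible; first exact: bigcupT_measurable.
  apply: negligible_bigcup => n; apply/negligibleP; first exact: mZ.
  by rewrite /Z; case: ifP => [/eqP|_].
have mZZ : measurable (\bigcup_n Z n) by exact: bigcupT_measurable.
exists (P `\` \bigcup_n Z n); split.
- exact: subDsetl.
- exact: measurableD.
- move=> O oO [y [Oy [Py nZy]]].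
  have [n [Bny BO]] := baseB y O (PK _ Py) (open_nbhs_nbhs (conj oO Oy)).
  have BP0 : eta (B n `&` P) != 0%E.
    by apply/eqP => BP0; apply: nZy; exists n => //; rewrite /Z BP0 eqxx.
  have mO : measurable (O : set (borel M)) by exact: sub_sigma_algebra.
  rewrite lt0e measure_ge0 andbT; apply: contra BP0 => /eqP OP0.
  rewrite eq_le measure_ge0 andbT.
  have sub : B n `&` P `<=` (O `&` (P `\` \bigcup_n Z n)) `|` \bigcup_n Z n.
    move=> z [Bz Pz]; have [zZ|zZ] := pselect ((\bigcup_n Z n) z); first by right.
    by left; split=> //; exact: BO.
  have mOP : measurable (O `&` (P `\` \bigcup_n Z n) : set (borel M)).
    by apply: measurableI => //; exact: measurableD.
  apply: (@le_trans _ _ (eta ((O `&` (P `\` \bigcup_n Z n)) `|` \bigcup_n Z n))).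
    by apply: le_measure; rewrite ?inE //; [exact: measurableI|exact: measurableU].
  by rewrite -(adde0 0%E) -[X in (X + _)%E]OP0 -Z0 measureU2.
- by rewrite setDD; apply: subset_measure0 Z0 => //; exact: measurableI.
Qed.

End charged.

(** * Invariant partitions from spanning sets *)

Section construction.
Context {R : realType} {M Omega : pmetricType R} (f : M * Omega -> M).
Context (Q : set M) (eta : probability (borel M) R) (tau : nat).
Local Notation U := {ptws nat -> Omega}.

(** Blocks of an invariant partition are nonempty; dropping the empty members of
    a disjoint cover only lowers their number. *)
Lemma inv_partition_of_cover m (F : 'I_m -> set M)
    (w : 'I_m -> tau.-tuple Omega) : (0 < tau)%N ->
  (forall i, measurable (F i : set (borel M))) ->
  cover setT F = Q -> trivIset setT F ->
  (forall i, {ae eta, forall x, F i x -> forall k, (1 <= k <= tau)%N ->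
     Q (sol_fin f k x (w i))}) ->
  exists C : inv_partition f Q eta tau, (ip_size C <= m)%N /\
    forall i, exists j, ip_block (i : 'I_(ip_size C)) = F j.
Proof.
move=> tau0 mF cF tF invF.
pose A := [set i : 'I_m | `[< F i !=set0 >]]%SET.
pose e (i : 'I_#|A|) : 'I_m := enum_val i.
have part : partition setT (fun i => F (e i)) Q.
  split.
  - rewrite -cF; apply/seteqP; split=> x [i _ Fx]; first by exists (e i).
    have iA : i \in A by rewrite inE; apply/asboolP; exists x.
    by exists (enum_rank_in iA i) => //; rewrite /e enum_rankK_in.
  - move=> i j _ _ ij; apply: enum_val_inj; exact: tF.
  - move=> i _; have := enum_valP i; by rewrite inE => /asboolP.
exists (@InvPartition R M Omega f Q eta tau #|A| (fun i => F (e i))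
  (fun i => w (e i)) tau0 (fun i => mF (e i)) part (fun i => invF (e i))).
split=> /=; first by rewrite -[X in (_ <= X)%N]card_ord max_card.
by move=> i; exists (e i).
Qed.

Hypotheses (cf : continuous f) (cQ : compact Q) (tau0 : (0 < tau)%N).

Lemma sol_fin_take (u : nat -> Omega) (x : M) k : (k <= tau)%N ->
  sol_fin f k x (mktuple (fun i : 'I_tau => u i)) = sol f k x u.
Proof.
move=> ktau; rewrite /sol_fin; apply: sol_ext => i ik.
have itau : (i < tau)%N by exact: leq_trans ktau.
by rewrite (nth_mktuple (fun i : 'I_tau => u i) point (Ordinal itau)).
Qed.

(** The points that the i-th control of the spanning set keeps in Q up to time
    tau form the closed set G i. These sets cover Q; they are made disjoint, then
    replaced by their charged parts P i, and the null remainder N becomes a block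
    of its own. Each control works everywhere on its block, and any control works
    on N, where invariance is required only almost everywhere. *)
Lemma charged_inv_partition (r : nat) (S : set U) : (S #= `I_r)%card ->
  spanning f tau Q S ->
  exists C : inv_partition f Q eta tau, (ip_size C <= r.+1)%N /\
    forall i : 'I_(ip_size C),
      eta (ip_block i) = 0%E \/ charged eta (ip_block i).
Proof.
rewrite card_eq_sym => /card_set_bijP [u [_ _ surjS]] spanS.
have clQ : closed Q by apply: compact_closed => //; exact: metric_hausdorff.
have mQ : measurable (Q : set (borel M)) by exact: measurable_compact.
pose G i : set (borel M) := Q `&`
  \bigcap_(k in [set k | (1 <= k <= tau)%N]) ((fun x => sol f k x (u i)) @^-1` Q).
have mG i : measurable (G i).
  apply: measurableI => //; apply: bigcap_measurableType => k _.
  rewrite -[X in measurable X]setCK; apply: measurableC; apply: sub_sigma_algebra.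
  apply: closed_openC; apply: preimage_closed => // x _.
  apply: (@continuous_sol _ _ _ f cf M id (fun=> u i) k) => [y|j y].
    exact: cvg_id.
  exact: cvg_cst.
have GQ i : seqDU G i `<=` Q by move=> x xD; have [] := subset_seqDU xD.
have mDG i : measurable (seqDU G i : set (borel M)).
  by apply: measurableD => //; apply: bigsetU_measurable.
have /choice[P hP] := fun i => charged_part eta cQ (GQ i) (mDG i).
have PD i : P i `<=` seqDU G i by have [] := hP i.
have mP i : measurable (P i) by have [] := hP i.
pose N : set (borel M) := Q `\` \bigcup_(i < r) P i.
have QG : Q `<=` \bigcup_(i < r) seqDU G i.
  move=> x Qx; have [v Sv vx] := spanS x Qx; have [i ir iv] := surjS v Sv.
  have : (\bigcup_(i < r) G i) x.
    by exists i => //; split=> // k /= kt; rewrite iv; exact: vx.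
  by rewrite bigcup_mkord bigsetU_seqDU -bigcup_mkord.
have mN : measurable N by apply: measurableD => //; exact: bigcup_measurable.
have N0 : eta N = 0%E.
  apply: measure_negligible => //.
  apply: (@negligibleS _ _ _ _ (\bigcup_(i < r) (seqDU G i `\` P i))).
    move=> x [Qx nP]; have [i ir Gx] := QG x Qx; exists i => //; split=> // Px.
    by apply: nP; exists i.
  apply: (@negligibleS _ _ _ _ (\bigcup_i (seqDU G i `\` P i))).
    by move=> x [i _ Gx]; exists i.
  apply: negligible_bigcup => i; apply/negligibleP; first exact: measurableD.
  by have [] := hP i.
pose F (i : 'I_r.+1) : set M := if (i < r)%N then P i else N.
(* The index r of the null block is outside the enumeration of the spanning set,
   so that [u r] is an arbitrary control. *)
pose w (i : 'I_r.+1) := mktuple (fun j : 'I_tau => u i j).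
have [||||C [sC bC]] := @inv_partition_of_cover r.+1 F w tau0.
- by move=> i; rewrite /F; case: ifP.
- apply/seteqP; split=> [x [i _]|x Qx].
    rewrite /F; case: ifP => _ h; last by case: h.
    by apply: (GQ i); exact: PD.
  have [[i ir Px]|nP] := pselect ((\bigcup_(i < r) P i) x).
    by exists (Ordinal (ltn_trans ir (ltnSn r))) => //; rewrite /F /= ir.
  by exists ord_max => //; rewrite /F ltnn.
- move=> i j _ _ [x []]; rewrite /F; case: ifP => ir; case: ifP => jr.
  + move=> Pi Pj; apply: val_inj; apply: (@trivIset_seqDU _ G) => //.
    by exists x; split; exact: PD.
  + by move=> Pi [_ nP]; case: nP; exists i.
  + by move=> [_ nP] Pj; case: nP; exists j.
  + move=> _ _; apply: val_inj => /=; apply/eqP.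
    have ri : (r <= i)%N by rewrite leqNgt ir.
    have rj : (r <= j)%N by rewrite leqNgt jr.
    by rewrite eqn_leq (leq_trans (leq_ord i) rj) (leq_trans (leq_ord j) ri).
- move=> i; rewrite /F; case: ifP => ir.
    apply: aeW => x Px k kt; rewrite sol_fin_take; last by case/andP: kt.
    by have [_ Gx] := subset_seqDU (PD i x Px); exact: Gx.
  exists N; split=> // x nx; apply: contrapT => nNx; apply: nx => Nx.
  by case: nNx.
exists C; split=> // i; have [j ->] := bC i; rewrite /F; case: ifP => _.
  by right; have [] := hP j.
by left.
Qed.

End construction.

(** * Total mass of the word sets *)

Section words.
Context {R : realType} {M Omega : pmetricType R} (f : M * Omega -> M).
Context (Q : set M) (eta : probability (borel M) R) (tau : nat).
Local Notation U := {ptws nat -> Omega}.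
Variable C : inv_partition f Q eta tau.

Lemma block_sub (i : 'I_(ip_size C)) : ip_block i `<=` Q.
Proof.
have [cov _ _] := ip_partition C => x Px.
have : cover setT (@ip_block _ _ _ _ _ _ _ C) x by exists i.
by rewrite cov.
Qed.

Lemma word_setP n (a : n.-tuple 'I_(ip_size C)) (z : U * M) :
  word_set a z <-> forall i : 'I_n,
    {ae eta, forall x, ip_block (tnth a i) x -> forall k, (1 <= k <= tau)%N ->
       Q (sol f k x (fun j => z.1 (j + i * tau)%N))} /\
    ip_block (tnth a i) (sol f (i * tau) z.2 z.1).
Proof.
split=> [h i|h i _]; first by have := h i I; rewrite /= iter_skew => -[].
by rewrite /= iter_skew; exact: h.
Qed.

(** The word can be read off from any point of its word set, since the state at
    time i tau lies in exactly one block. *)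
Lemma word_set_inj n (a b : n.-tuple 'I_(ip_size C)) :
  word_set a `&` word_set b !=set0 -> a = b.
Proof.
case=> z [/word_setP az /word_setP bz]; apply: eq_from_tnth => i.
have [_ tI _] := ip_partition C; apply: tI => //.
by exists (sol f (i * tau) z.2 z.1); split; [have [] := az i|have [] := bz i].
Qed.

Lemma finite_word_sets (mu : set (U * M) -> \bar R) n :
  finite_set (word_sets mu C n).
Proof. by apply: finite_image; exact: finite_finset. Qed.

Lemma card_word_sets (mu : set (U * M) -> \bar R) n :
  (size (fset_set (word_sets mu C n)) <= ip_size C ^ n)%N.
Proof.
have -> : (ip_size C ^ n = #|{: n.-tuple 'I_(ip_size C)}|)%N.
  by rewrite card_tuple card_ord.
rewrite cardE -(size_map (@word_set _ _ _ f Q eta tau C n)).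
apply: uniq_leq_size; first exact: fset_uniq.
move=> D; rewrite in_fset_set ?inE; last exact: finite_word_sets.
by move=> [a _ <-]; apply: map_f; rewrite mem_enum.
Qed.

Lemma trivIset_word_sets (mu : set (U * M) -> \bar R) n :
  trivIset (word_sets mu C n) id.
Proof. by move=> _ _ [a _ <-] [b _ <-] /word_set_inj ->. Qed.

Hypotheses (cf : continuous f) (cQ : compact Q).
Hypothesis chC : forall i : 'I_(ip_size C),
  eta (ip_block i) = 0%E \/ charged eta (ip_block i).

Let clQ : closed Q.
Proof. by apply: compact_closed => //; exact: metric_hausdorff. Qed.

Lemma charged_block_invariant (i : 'I_(ip_size C)) (v : nat -> Omega) :
  charged eta (ip_block i) ->
  {ae eta, forall x, ip_block i x -> forall k, (1 <= k <= tau)%N ->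
     Q (sol f k x v)} ->
  forall x, ip_block i x -> forall k, (1 <= k <= tau)%N -> Q (sol f k x v).
Proof.
move=> chi aei x Px k kt; have mi := @ip_measurable _ _ _ _ _ _ _ C i.
apply: (@charged_ae _ _ eta _ [set x | Q (sol f k x v)] mi chi) => //.
  apply: preimage_closed => // y _.
  apply: (@continuous_sol _ _ _ f cf M id (fun=> v) k) => [t|j t].
    exact: cvg_id.
  exact: cvg_cst.
case: aei => [N [mN N0 sN]]; exists N; split=> //; apply: subset_trans sN.
by move=> y /= nh h; apply: nh => Py; exact: h.
Qed.

(** For a charged block the set of controls is defined by conditions at every
    point of the block, so it is an intersection of closed sets; for a null block
    it contains every control. The offset [j] serves the shifted controls that
    occur in word sets. *)
Lemma measurable_block_controls (i : 'I_(ip_size C)) j :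
  measurable ([set u : U | {ae eta, forall x, ip_block i x ->
     forall k, (1 <= k <= tau)%N -> Q (sol f k x (fun l => u (l + j)%N))}] :
     set (borel U)).
Proof.
have [i0|chi] := chC i.
  rewrite (_ : [set u : U | _] = setT) //; apply/seteqP; split=> // u _ /=.
  exists (ip_block i); split=> //; first exact: ip_measurable.
  by move=> x nx; apply: contrapT => nPx; apply: nx => Px.
rewrite (_ : [set u : U | _] = \bigcap_(xk in [set xk : M * nat |
    ip_block i xk.1 /\ (1 <= xk.2 <= tau)%N])
    [set u : U | Q (sol f xk.2 xk.1 (fun l => u (l + j)%N))]); last first.
  apply/seteqP; split=> u /= h.
    by move=> [x k] /= [Px kt]; exact: (charged_block_invariant chi h).
  by apply: aeW => x Px k kt; exact: (h (x, k)).
rewrite -[X in measurable X]setCK; apply: measurableC; apply: sub_sigma_algebra.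
apply: closed_openC; apply: closed_bigI => -[x k] _ /=.
apply: preimage_closed => // u _.
apply: (@continuous_sol _ _ _ f cf U (fun=> x) (fun u l => u (l + j)%N) k).
  exact: cst_continuous.
by move=> l; exact: (@continuous_coord R Omega (l + j)%N).
Qed.

Lemma measurable_word_set n (a : n.+1.-tuple 'I_(ip_size C)) :
  measurable (word_set a : set (borel U * borel M)).
Proof.
rewrite (_ : word_set a = \bigcap_(i : 'I_n.+1)
   (([set u : U | {ae eta, forall x, ip_block (tnth a i) x ->
     forall k, (1 <= k <= tau)%N -> Q (sol f k x (fun l => u (l + i * tau)%N))}]
     `*` setT) `&`
    [set z : U * M | Q z.2 /\ ip_block (tnth a i) (sol f (i * tau) z.2 z.1)])).
  apply: fin_bigcap_measurable => // i _; apply: measurableI.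
    by apply: measurableX => //; exact: measurable_block_controls.
  by apply: measurable_over_Q => //; exact: ip_measurable.
apply/seteqP; split=> z.
  move/word_setP => h i _; have [h1 h2] := h i; split=> //; split=> //.
  by have [_ /=] := h ord0; exact: block_sub.
move=> h; apply/word_setP => i; have [[h1 _] [_ h2]] := h i I.
by split.
Qed.

Definition null_part : set M :=
  \bigcup_(i in [set i : 'I_(ip_size C) | eta (ip_block i) = 0%E]) ip_block i.

Lemma measurable_null_part : measurable (null_part : set (borel M)).
Proof.
apply: fin_bigcup_measurable; first exact: finite_finset.
by move=> i _; exact: ip_measurable.
Qed.

Lemma null_part_sub : null_part `<=` Q.
Proof. by move=> x [i _]; exact: block_sub. Qed.

Lemma null_part0 : eta null_part = 0%E.
Proof.
rewrite measure_fin_bigcup //.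
- by apply: fsbig1.
- exact: finite_finset.
- have [_ tI _] := ip_partition C; exact: (sub_trivIset _ tI).
- by move=> i _; exact: ip_measurable.
Qed.

(** As long as the trajectory meets charged blocks at the times j tau, the control
    is effective at the very point that is visited, and the trajectory survives
    for tau more steps. The first visit to a null block happens at a time up to
    which it has survived. *)
Lemma word_set_sub n (a : n.+1.-tuple 'I_(ip_size C)) :
  word_set a `<=` survive f Q (n * tau) Q `|`
    \bigcup_j survive f Q (j * tau) null_part.
Proof.
move=> z /word_setP az.
have [hN|hN] := pselect (exists2 j, (j < n.+1)%N & survive f Q (j * tau) null_part z).
  by right; have [j jn jN] := hN; exists j.
left.
suff h j : (j <= n)%N -> survive f Q (j * tau) Q z by exact: h.
elim: j => [_|j IH jn].
  have [_ h0] := az ord0; have {}h0 := block_sub h0.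
  by rewrite mul0n in h0 *; split=> // -[|].
have {}IH := IH (ltnW jn).
have jn1 : (j < n.+1)%N by rewrite ltnS ltnW.
have [h1 h2] := az (Ordinal jn1); rewrite /= in h1 h2.
set i := tnth a _ in h1 h2.
have chi : charged eta (ip_block i).
  case: (chC i) => // i0; exfalso; apply: hN; exists j => //.
  by split; [have [] := IH|exists i].
have {}h1 := charged_block_invariant chi h1 h2.
have all_in k : (k <= j.+1 * tau)%N -> Q (sol f k z.2 z.1).
  have [kj _|jk kj] := leqP k (j * tau); first by have [h _] := IH; exact: h.
  rewrite -(subnKC (ltnW jk)) sol_add; apply: h1.
  by rewrite subn_gt0 jk leq_subLR -mulSnr.
by split=> //; exact: all_in.
Qed.

Variables (nu : probability (borel Omega) R) (nuN : probability (borel U) R).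
Hypothesis hnuN : power_measure nu nuN.
Variable rho : R.
Hypothesis heta : quasi_stationary f nu Q eta rho.

Lemma word_sets_mass n :
  (\sum_(D \in word_sets (nuN \x eta) C n.+1) (nuN \x eta) D <= (rho ^+ (n * tau))%:E)%E.
Proof.
have mQ : measurable (Q : set (borel M)) by exact: measurable_compact.
have mW D : word_sets (nuN \x eta)%E C n.+1 D -> measurable (D : set (borel U * borel M)).
  by move=> [a _ <-]; exact: measurable_word_set.
have fW := finite_word_sets (nuN \x eta)%E n.+1.
have tW := @trivIset_word_sets (nuN \x eta)%E n.+1.
have mUW : measurable (\bigcup_(D in word_sets (nuN \x eta)%E C n.+1) D :
    set (borel U * borel M)) by exact: fin_bigcup_measurable.
have -> : (\sum_(D \in word_sets (nuN \x eta) C n.+1) (nuN \x eta) D)%E =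
    (nuN \x eta)%E (\bigcup_(D in word_sets (nuN \x eta)%E C n.+1) D).
  by apply/esym; exact: (@measure_fin_bigcup _ _ _ (nuN \x eta)%E).
set J := \bigcup_j survive f Q (j * tau) null_part.
have mS j B : measurable (B : set (borel M)) ->
    measurable (survive f Q j B : set (borel U * borel M)).
  exact: measurable_survive.
have mJ : measurable (J : set (borel U * borel M)).
  by apply: bigcupT_measurable => j; apply: mS; exact: measurable_null_part.
have J0 : (nuN \x eta)%E J = 0%E.
  apply: measure_negligible => //.
  apply: negligible_bigcup => j; apply/negligibleP.
    by apply: mS; exact: measurable_null_part.
  have := survive_law cf cQ hnuN heta (j * tau) measurable_null_part null_part_sub.
  by rewrite null_part0 mule0.
have [_ etaQ _] := heta.
have QE := survive_law cf cQ hnuN heta (n * tau) mQ (@subset_refl _ Q).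
rewrite etaQ mule1 in QE.
apply: (@le_trans _ _ ((nuN \x eta)%E (survive f Q (n * tau) Q `|` J))).
  apply: le_measure; rewrite ?inE //; first by apply: measurableU => //; exact: mS.
  by move=> z [_ [a _ <-]]; exact: word_set_sub.
rewrite -[leRHS]adde0 -QE -J0; apply: measureU2 => //; exact: mS.
Qed.

End words.

(** * From the mass bound to the entropy of a partition *)

Section limsup.
Import numFieldNormedType.Exports.
Context {R : realType}.

(** The index 0 is excluded because the averages below divide by it. *)
Lemma limn_esup_le_lim (u v : (\bar R)^nat) (l : \bar R) :
  (forall n, (0 < n)%N -> (u n <= v n)%E) -> v @ \oo --> l ->
  (limn_esup u <= l)%E.
Proof.
move=> uv vl; have [_ <-] := cvg_limn_einf_sup vl.
rewrite !limn_esup_lim; apply: lee_lim; [exact: is_cvg_esups|exact: is_cvg_esups|].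
near=> n; apply: ge_ereal_sup => _ [k /= nk <-].
have k0 : (0 < k)%N by apply: leq_trans nk; near: n; exists 1%N.
apply: (le_trans (uv k k0)); apply: ereal_sup_ubound; by exists k.
Unshelve. all: by end_near. Qed.

Lemma cvg_invn_mul (a : R) : (fun n : nat => n%:R^-1 * a) @ \oo --> 0.
Proof.
have := cvgMr_tmp (b := a) (@cvg_harmonic R); rewrite mul0r => h.
by rewrite -cvg_shiftS; exact: h.
Qed.

Lemma cvge_invn_mul (a : R) : (fun n : nat => (n%:R^-1 * a)%:E) @ \oo --> 0%E.
Proof. by apply: cvg_EFin; [exact: nearW|exact: cvg_invn_mul]. Qed.

End limsup.

Section gibbs.
Context {R : realType}.

(** Gibbs inequality for the uniform weight 1 / N: this is ln t <= t - 1 at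
    t = 1 / (N m), multiplied by m. *)
Lemma oppxlnx_le (N m : R) : 0 < N -> 0 <= m ->
  - xlnx m <= N^-1 - m + m * ln N.
Proof.
move=> N0; rewrite le_eqVlt => /orP[/eqP <-|m0].
  by rewrite /xlnx !mul0r oppr0 !addr0 invr_ge0 ltW.
have Nm0 : 0 < (N * m)^-1 by rewrite invr_gt0 mulr_gt0.
have : ln (1 + ((N * m)^-1 - 1)) <= (N * m)^-1 - 1.
  by apply: le_ln1Dx; rewrite -subr_gt0 opprK subrK.
rewrite addrCA subrr addr0 lnV ?posrE ?mulr_gt0 // lnM ?posrE // => h.
have := ler_wpM2l (ltW m0) h.
rewrite invfM mulrBr mulr1 mulrCA divff ?gt_eqF // mulr1 mulrN mulrDr opprD.
by rewrite /xlnx addrC lerBlDr.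
Qed.

(** For total mass 1 the entropy of N sets is at most ln N; a smaller total mass
    costs at most the additional 1. *)
Lemma entropy_le (T : Type) (m : set T -> \bar R) (CC : set (set T)) (N : nat) :
  finite_set CC -> (0 < N)%N -> (size (fset_set CC) <= N)%N ->
  (forall D, CC D -> 0 <= fine (m D)) ->
  \sum_(D \in CC) fine (m D) <= 1 ->
  entropy m CC <= 1 + ln N%:R.
Proof.
move=> fCC N0 sN m0; rewrite /entropy !fsbig_finite //= => m1.
have NR0 : 0 < N%:R :> R by rewrite ltr0n.
rewrite -sumrN.
apply: (@le_trans _ _ (\sum_(D <- fset_set CC)
    (N%:R^-1 - fine (m D) + fine (m D) * ln N%:R))).
  rewrite [leLHS]big_seq [leRHS]big_seq; apply: ler_sum => D.
  by rewrite in_fset_set // inE => DC; apply: oppxlnx_le => //; exact: m0.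
rewrite big_split /= sumrB -mulr_suml.
have s0 : 0 <= \sum_(D <- fset_set CC) fine (m D).
  rewrite big_seq; apply: sumr_ge0 => D; rewrite in_fset_set // inE; exact: m0.
rewrite big_const_seq count_predT iter_addr_0.
apply: lerD.
  rewrite lerBlDr ler_wpDr // -[leLHS]mulr_natl ler_pdivrMr // mul1r.
  by rewrite ler_nat.
by rewrite ler_piMl // ln_ge0 // ler1n.
Qed.

End gibbs.

Section partition_entropy_bound.
Import numFieldNormedType.Exports.
Context {R : realType} {M Omega : pmetricType R} (f : M * Omega -> M).
Local Notation U := {ptws nat -> Omega}.
Hypothesis cf : continuous f.
Variables (Q : set M) (cQ : compact Q).
Variables (nu : probability (borel Omega) R) (nuN : probability (borel U) R).
Hypothesis hnuN : power_measure nu nuN.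
Variables (eta : probability (borel M) R) (rho : R).
Hypothesis heta : quasi_stationary f nu Q eta rho.

Lemma partition_entropy_le tau (C : inv_partition f Q eta tau) :
  (0 < ip_size C)%N ->
  (forall i : 'I_(ip_size C), eta (ip_block i) = 0%E \/ charged eta (ip_block i)) ->
  (partition_entropy rho (nuN \x eta) C <= (ln (ip_size C)%:R / tau%:R)%:E)%E.
Proof.
move=> C0 chC; have [/andP[rho0 _] _ _] := heta.
have tau0 : (0 < tau)%N by exact: ip_tau_gt0 C.
set q := ip_size C.
apply: (@limn_esup_le_lim _ _
  (fun n => (((n%:R : R)^-1 * tau%:R^-1 + ln q%:R / tau%:R))%:E)).
  move=> [//|n] _; rewrite lee_fin.
  have W : entropy (fun A => ((rho ^- (n.+1.-1 * tau))%:E * (nuN \x eta)%E A)%E)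
      (word_sets (nuN \x eta)%E C n.+1) <= 1 + ln (q ^ n.+1)%:R.
    have fW := finite_word_sets C (nuN \x eta)%E n.+1.
    have mufin D : word_sets (nuN \x eta)%E C n.+1 D ->
        (nuN \x eta)%E D \is a fin_num.
      move=> [a _ <-]; have mWa := measurable_word_set cf cQ chC a.
      rewrite ge0_fin_numE //; apply: le_lt_trans (ltry 1).
      have -> : 1%E = (nuN \x eta)%E setT.
        transitivity (nuN setT * eta setT)%E.
          by rewrite !probability_setT mule1.
        by rewrite -product_measure1E // setXTT.
      by apply: le_measure; rewrite ?inE.
    have rr : 0 < rho ^+ (n * tau) by exact: exprn_gt0.
    have fineE D : word_sets (nuN \x eta)%E C n.+1 D ->
        fine ((rho ^- (n.+1.-1 * tau))%:E * (nuN \x eta)%E D)%E =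
        rho ^- (n * tau) * fine ((nuN \x eta)%E D).
      by move=> WD; rewrite fineM // mufin.
    apply: entropy_le => //.
    - by rewrite expn_gt0 C0.
    - exact: card_word_sets.
    - by move=> D WD; rewrite fineE // mulr_ge0 ?invr_ge0 ?(ltW rr) // fine_ge0.
    have := word_sets_mass cf cQ chC hnuN heta n.
    rewrite !fsbig_finite //= => mass.
    rewrite big_seq (eq_bigr (fun D => rho ^- (n * tau) * fine ((nuN \x eta)%E D))); last first.
      by move=> D; rewrite in_fset_set // inE => WD; exact: fineE.
    rewrite -big_seq -mulr_sumr ler_pdivrMl // mulr1 -lee_fin.
    apply: le_trans mass; rewrite -sumEFin le_eqVlt; apply/orP; left; apply/eqP.
    rewrite big_seq [RHS]big_seq; apply: eq_bigr => D; rewrite in_fset_set // inE => WD.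
    by rewrite fineK // mufin.
  have nt0 : 0 < (n.+1 * tau)%:R :> R by rewrite ltr0n muln_gt0.
  apply: (le_trans (ler_wpM2l _ W)); first by rewrite invr_ge0 ltW.
  rewrite natrX lnXn ?ltr0n // mulrDr mulr1 natrM invfM lerD2l.
  rewrite -[ln _ *+ _]mulr_natl mulrACA mulVf ?pnatr_eq0 // mul1r.
  by rewrite mulrC.
apply: cvg_EFin; first by apply: nearW.
rewrite -[X in _ --> X]add0r; apply: cvgD; last exact: cvg_cst.
exact: cvg_invn_mul.
Qed.

End partition_entropy_bound.

(** * Existence of the topological invariance entropy *)

Section fekete.
Context {R : realType}.
Import numFieldNormedType.Exports.

Lemma subadditive_mulS (a : nat -> R) : (forall m n, a (m + n)%N <= a m + a n) ->
  forall q m s, a (q * m + s)%N <= q%:R * a m + a s.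
Proof.
move=> asub q m s; elim: q => [|q IH]; first by rewrite mul0n mul0r !add0r add0n.
rewrite mulSn -addnA; apply: (le_trans (asub _ _)).
by rewrite -natr1 mulrDl mul1r [_ + a m]addrC -addrA lerD2l.
Qed.

(** Writing n = q m + s with s < m gives a n <= q a m + b for a constant b that
    depends on m only, so a n / n exceeds a m / m by at most b / n. Taking a m / m
    close to its infimum over m shows that the sequence converges to it. *)
Lemma fekete (a : nat -> R) : (forall n, 0 <= a n) ->
  (forall m n, a (m + n)%N <= a m + a n) ->
  cvgn (fun n => n%:R^-1 * a n).
Proof.
move=> a0 asub.
pose E : set R := [set n%:R^-1 * a n | n in [set n | (0 < n)%N]].
have lbE : lbound E 0 by move=> _ [n _ <-]; rewrite mulr_ge0 ?invr_ge0.
have hE : has_inf E.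
  by split; [exists (1%:R^-1 * a 1%N), 1%N|exists 0].
apply/cvg_ex; exists (inf E); apply/cvgrPdist_le => e e0.
have e20 : 0 < e / 2 by rewrite divr_gt0.
have [_ [m /= m0 <-] mE] := inf_adherent e20 hE.
have mR : 0 < m%:R :> R by rewrite ltr0n.
pose b := \sum_(s < m) a s.
have ab s : (s < m)%N -> a s <= b.
  move=> sm; rewrite /b (bigD1 (Ordinal sm)) //= lerDl.
  exact: sumr_ge0.
have bcvg : \forall n \near \oo, n%:R^-1 * b <= e / 2.
  have /cvgrPdist_le/(_ _ e20) := cvg_invn_mul b.
  apply: filterS => n; rewrite sub0r normrN; apply: le_trans; exact: ler_norm.
near=> n.
have n0 : (0 < n)%N by near: n; exists 1%N.
have nR : 0 < n%:R :> R by rewrite ltr0n.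
have infn : inf E <= n%:R^-1 * a n.
  by apply: ge_inf; [exists 0|exists n].
rewrite distrC ger0_norm ?subr_ge0 // lerBlDl.
have bn : n%:R^-1 * b <= e / 2 by near: n; exact: bcvg.
rewrite [e]splitr addrA.
apply: (@le_trans _ _ (m%:R^-1 * a m + n%:R^-1 * b)); last first.
  by apply: lerD => //; exact: ltW.
rewrite ler_pdivrMl // mulrDr mulVKf ?gt_eqF //.
rewrite {1}(divn_eq n m).
apply: (le_trans (subadditive_mulS asub _ _ _)).
apply: lerD; last by apply: ab; rewrite ltn_mod.
rewrite mulrA; apply: ler_wpM2r => //.
by rewrite ler_pdivlMr // -natrM ler_nat leq_divM.
Unshelve. all: by end_near. Qed.

End fekete.

Section spanning_numbers.
Context {R : realType} {M Omega : pmetricType R} (f : M * Omega -> M).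
Context (Q : set M).
Local Notation U := {ptws nat -> Omega}.

Definition spanning_card (tau : nat) : set nat :=
  [set n : nat | exists2 S : set U, (S #= `I_n)%card & spanning f tau Q S].

(** A family may repeat controls, so the set it spans can be smaller than its
    index type. *)
Lemma spanning_card_family tau (I : finType) (u : I -> U) :
  spanning f tau Q (range u) ->
  exists2 n, (n <= #|I|)%N & spanning_card tau n.
Proof.
move=> sp; have fu : finite_set (range u).
  by apply: finite_image; exact: finite_finset.
have [n Sn] := fu; exists n; last by exists (range u).
rewrite -(card_fset_set Sn) cardE -(size_map u).
apply: uniq_leq_size; first exact: fset_uniq.
move=> v; rewrite in_fset_set ?inE // => -[i _ <-].
by apply: map_f; rewrite mem_enum.
Qed.

Lemma spanning_enum tau n : spanning_card tau n ->
  exists u : 'I_n -> U, spanning f tau Q (range u).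
Proof.
move=> [S]; rewrite card_eq_sym => /card_set_bijP [u [_ _ surjS]] spS.
exists (fun i : 'I_n => u i) => x Qx; have [v Sv vx] := spS x Qx.
by have [i i_n iv] := surjS v Sv; exists v => //; exists (Ordinal i_n).
Qed.

Lemma spanning_card_gt0 tau n : Q !=set0 -> spanning_card tau n -> (0 < n)%N.
Proof.
move=> [x Qx] /spanning_enum [u sp]; have [_ [i _ _] _] := sp x Qx.
by apply: leq_ltn_trans (ltn_ord i).
Qed.

Lemma spanning_card_le s t n : (s <= t)%N -> spanning_card t n -> spanning_card s n.
Proof.
move=> st [S Sn sp]; exists S => // x Qx; have [v Sv vx] := sp x Qx.
by exists v => // k /andP[k1 ks]; apply: vx; rewrite k1 (leq_trans ks).
Qed.

(** A control from the first set leads to a point of Q, from which a control from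
    the second set continues: concatenations span the longer time. *)
Lemma spanning_cardD s t m n : spanning_card s m -> spanning_card t n ->
  exists2 k, (k <= m * n)%N & spanning_card (s + t) k.
Proof.
move=> /spanning_enum [u spu] /spanning_enum [v spv].
pose w (ij : 'I_m * 'I_n) : U :=
  fun l => if (l < s)%N then u ij.1 l else v ij.2 (l - s)%N.
rewrite -[m]card_ord -[in X in (_ * X)%N](card_ord n) -card_prod.
apply: (@spanning_card_family _ _ w) => x Qx.
have [_ [i _ <-] ux] := spu x Qx.
have wu k j : (k <= s)%N -> sol f k x (w (i, j)) = sol f k x (u i).
  by move=> ks; apply: sol_ext => l lk; rewrite /w /= (leq_trans lk ks).
have Qs : Q (sol f s x (u i)).
  by case: s ux {wu spu w} => // s ux; apply: ux; rewrite leqnn.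
have [_ [j _ <-] vx] := spv _ Qs.
exists (w (i, j)); first by exists (i, j).
move=> k /andP[k1 kst]; have [ks|sk] := leqP k s.
  by rewrite wu //; apply: ux; rewrite k1.
rewrite -(subnKC (ltnW sk)) sol_add wu //.
rewrite (@sol_ext _ _ _ _ _ _ _ (v j)); last first.
  by move=> l _; rewrite /w /= ltnNge leq_addl /= addnK.
by apply: vx; rewrite subn_gt0 sk leq_subLR.
Qed.

Lemma r_inv_min tau n : spanning_card tau n ->
  (forall k, spanning_card tau k -> (n <= k)%N) ->
  r_inv f tau Q = (n%:R)%:E.
Proof.
move=> hn nmin; apply/eqP; rewrite eq_le; apply/andP; split.
  by apply: ereal_inf_lbound; exists n.
by apply: le_ereal_inf_tmp => _ [k hk <-]; rewrite lee_fin ler_nat; exact: nmin.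
Qed.

Lemma r_inv_pinfty tau : spanning_card tau = set0 -> r_inv f tau Q = +oo%E.
Proof. by rewrite /r_inv -/(spanning_card tau) => ->; rewrite image_set0 ereal_inf0. Qed.

End spanning_numbers.

Section top_inv_entropy_limit.
Context {R : realType} {M Omega : pmetricType R} (f : M * Omega -> M).
Context (Q : set M).
Import numFieldNormedType.Exports.

(** A set spanning for a longer time also spans for a shorter one, so that from
    [tau0] on there is no finite spanning set. *)
Lemma top_inv_entropy_pinfty tau0 : spanning_card f Q tau0 = set0 ->
  top_inv_entropy f Q = +oo%E.
Proof.
move=> tau0E; apply/cvg_lim => //; apply: cvg_near_cst; near=> tau.
have tau_ge : (tau0 <= tau)%N by near: tau; exists tau0.
have tau_gt0 : (0 < tau)%N by near: tau; exists 1%N.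
rewrite r_inv_pinfty; last first.
  by rewrite -subset0 => n /(spanning_card_le tau_ge); rewrite tau0E.
by rewrite /= gt0_muley // lte_fin invr_gt0 ltr0n.
Unshelve. all: by end_near. Qed.

Lemma top_inv_entropy_cvg (r : nat -> nat) : Q !=set0 ->
  (forall tau, spanning_card f Q tau (r tau)) ->
  (forall tau n, spanning_card f Q tau n -> (r tau <= n)%N) ->
  (fun tau => (tau%:R^-1 * ln (r tau)%:R : R)%:E) @ \oo -->
  top_inv_entropy f Q.
Proof.
move=> Q0 hr rmin.
have r0 tau : (0 < r tau)%N by exact: spanning_card_gt0 (hr tau).
pose a tau : R := ln (r tau)%:R.
have a0 tau : 0 <= a tau by rewrite ln_ge0 // ler1n.
have asub s t : a (s + t)%N <= a s + a t.
  have [k km hk] := spanning_cardD (hr s) (hr t).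
  rewrite /a -lnM ?posrE ?ltr0n // -natrM ler_ln ?posrE ?ltr0n ?muln_gt0 ?r0 //.
  by rewrite ler_nat (leq_trans (rmin _ _ hk)).
have /cvg_ex[l al] := fekete a0 asub.
have el : (fun tau => (tau%:R^-1 * a tau)%:E) @ \oo --> l%:E.
  by apply: cvg_EFin; [exact: nearW|exact: al].
rewrite (_ : top_inv_entropy f Q = l%:E) //; apply/cvg_lim => //.
rewrite (_ : (fun tau : nat => _) = (fun tau => (tau%:R^-1 * a tau)%:E)) //.
apply/funext => tau; rewrite (r_inv_min (hr tau) (rmin tau)).
by rewrite lne_EFin ?ltr0n // -EFinM.
Qed.

End top_inv_entropy_limit.

Theorem theorem2p16 (R : realType) (M Omega : pmetricType R)
    (f : M * Omega -> M) (hf : continuous f)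
    (Q : set M) (hQ : compact Q) (hQinv : controlled_invariant f Q)
    (nu : probability (borel Omega) R)
    (nuN : probability (borel {ptws nat -> Omega}) R)
    (hnuN : power_measure nu nuN)
    (eta : probability (borel M) R) (rho : R)
    (heta : quasi_stationary f nu Q eta rho) :
  (metric_inv_entropy f Q eta rho (nuN \x eta) <= top_inv_entropy f Q)%E.
Proof.
have Q0 : Q !=set0.
  apply/set0P/eqP => Q0; have [_ + _] := heta.
  by rewrite Q0 measure0 => /eqP; rewrite eq_sym onee_eq0.
have [hfin|] := pselect (forall tau, spanning_card f Q tau !=set0); last first.
  move=> /existsNP[tau0 /set0P/negP/negPn/eqP tau0E].
  by rewrite (top_inv_entropy_pinfty tau0E) leey.
have /choice[r hr] : forall tau, exists n, spanning_card f Q tau n /\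
    forall k, spanning_card f Q tau k -> (n <= k)%N.
  move=> tau; have [n0 hn0] := hfin tau.
  pose p n := `[< spanning_card f Q tau n >].
  have ep : exists n, p n by exists n0; apply/asboolP.
  exists (ex_minn ep); case: ex_minnP => m /asboolP pm mmin; split=> // k hk.
  by apply: mmin; apply/asboolP.
have rspan tau : spanning_card f Q tau (r tau) by have [] := hr tau.
have rmin tau n : spanning_card f Q tau n -> (r tau <= n)%N.
  by have [_] := hr tau; exact.
have r0 tau : (0 < r tau)%N by exact: spanning_card_gt0 (rspan tau).
have topE := top_inv_entropy_cvg Q0 rspan rmin.
(* The extra null block costs a term ln 2 / tau, because r + 1 <= 2 r. *)
apply: (@limn_esup_le_lim _ _
    (fun tau => (tau%:R^-1 * ln 2)%:E + (tau%:R^-1 * ln (r tau)%:R)%:E)%E); last first.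
  rewrite -[top_inv_entropy f Q]add0e.
  by apply: cvgeD => //; exact: cvge_invn_mul.
move=> tau tau0; have [S Sr spS] := rspan tau.
have [C [sC chC]] := charged_inv_partition eta hf hQ tau0 Sr spS.
have C0 : (0 < ip_size C)%N.
  have [x Qx] := Q0; have [cov _ _] := ip_partition C.
  have : cover setT (@ip_block _ _ _ _ _ _ _ C) x by rewrite cov.
  by move=> [i _ _]; apply: leq_ltn_trans (ltn_ord i).
apply: (@le_trans _ _ (partition_entropy rho (nuN \x eta)%E C)).
  by apply: ereal_inf_lbound; exists C.
apply: (le_trans (partition_entropy_le hf hQ hnuN heta C0 chC)).
rewrite -EFinD lee_fin mulrC -mulrDr ler_wpM2l ?invr_ge0 //.
rewrite -lnM ?posrE ?ltr0n // -natrM ler_ln ?posrE ?ltr0n ?muln_gt0 ?r0 //.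
rewrite ler_nat (leq_trans sC) // mul2n -addnn.
by rewrite -addn1 leq_add2l.
Qed.
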